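(* The variety of $2$-solvable groups (regarded as a category, with all group homomorphisms as morphisms) is not weakly action representable.
   Context: The variety of $2$-solvable groups is the full subcategory of the category of groups consisting of all groups that are solvable of derived length at most $2$, i.e. groups $G$ with $[[G,G],[G,G]] = 1$. Let $\mathcal{C}$ be a semi-abelian category (every variety of groups is one). For objects $B, X$ of $\mathcal{C}$, a split extension of $B$ by $X$ is a diagram $X \xrightarrow{\,\kappa\,} A \overset{\alpha}{\underset{\beta}{\rightleftarrows}} B$ in $\mathcal{C}$ (with $\alpha\colon A \to B$, $\beta \colon B \to A$) such that $\alpha\circ\beta = \mathrm{id}_B$ and $(X,\kappa)$ is a kernel of $\alpha$. Two split extensions $(A,\kappa,\alpha,\beta)$ and $(A',\kappa',\alpha',\beta')$ of $B$ by $X$ are isomorphic if there is an isomorphism $\theta\colon A \to A'$ with $\theta\kappa = \kappa'$, $\alpha'\theta = \alpha$ and $\theta\beta = \beta'$. For a fixed object $X$, the functor $\mathrm{SplExt}(-,X)\colon \mathcal{C}^{op}\to \mathbf{Set}$ sends $B$ to the set of isomorphism classes of split extensions (in $\mathcal{C}$) of $B$ by $X$, and sends $f\colon B'\to B$ to the map $f^*\colon \mathrm{SplExt}(B,X)\to \mathrm{SplExt}(B',X)$ given by pulling back along $f$. The category $\mathcal{C}$ is weakly action representable if for every object $X$ of $\mathcal{C}$ there exist an object $T = T(X)$ of $\mathcal{C}$ and a natural monomorphism of functors (a natural transformation with all components injective) $\tau\colon \mathrm{SplExt}(-,X) \rightarrowtail \mathrm{Hom}_{\mathcal{C}}(-,T)$.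 *)

(* Defs.v *)
From HB Require Import structures.
From mathcomp Require Import all_boot.
From mathcomp Require Import boolp classical_sets.

Set Implicit Arguments.
Unset Strict Implicit.
Unset Printing Implicit Defensive.

Local Open Scope classical_set_scope.

Record category := Category {
  obj :> Type;
  hom : obj -> obj -> Type;
  idm : forall a, hom a a;
  comp : forall a b c, hom b c -> hom a b -> hom a c;
  comp_id_l : forall a b (f : hom a b), comp (idm b) f = f;
  comp_id_r : forall a b (f : hom a b), comp f (idm a) = f;
  comp_assoc : forall a b c d (h : hom c d) (g : hom b c) (f : hom a b),
    comp h (comp g f) = comp (comp h g) f
}.

Arguments hom {c} a b : rename.
Arguments idm {c} a : rename.
Arguments comp {c a b c0} g f : rename.
Arguments comp_id_l {c a b} f : rename.
Arguments comp_id_r {c a b} f : rename.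
Arguments comp_assoc {c a b c0 d} h g f : rename.

Declare Scope cat_scope.
Delimit Scope cat_scope with cat.
Notation "g ∘ f" := (comp g f) (at level 40, left associativity) : cat_scope.
Local Open Scope cat_scope.

Section Limits.
Variable C : category.
Implicit Types a b c d : C.

Definition isomorphism a b (f : hom a b) : Prop :=
  exists g : hom b a, g ∘ f = idm a /\ f ∘ g = idm b.

Definition zero_object (z : C) : Prop :=
  forall a, (exists! f : hom a z, True) /\ (exists! f : hom z a, True).

Definition zero_morphism a b (f : hom a b) : Prop :=
  exists (z : C) (g : hom z b) (h : hom a z), zero_object z /\ f = g ∘ h.

Definition is_kernel k a b (i : hom k a) (f : hom a b) : Prop :=
  zero_morphism (f ∘ i) /\
  forall c (g : hom c a), zero_morphism (f ∘ g) ->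
    exists! h : hom c k, i ∘ h = g.

Definition is_pullback p a b c
    (p1 : hom p a) (p2 : hom p b) (f : hom a c) (g : hom b c) : Prop :=
  f ∘ p1 = g ∘ p2 /\
  forall d (u : hom d a) (v : hom d b), f ∘ u = g ∘ v ->
    exists! h : hom d p, p1 ∘ h = u /\ p2 ∘ h = v.

End Limits.

Definition has_pullbacks (C : category) : Prop :=
  forall (a b c : C) (f : hom a c) (g : hom b c),
    exists (p : C) (p1 : hom p a) (p2 : hom p b), is_pullback p1 p2 f g.

(* Functors C^op -> Set; Rocq's Type plays the role of Set. *)
Record presheaf (C : category) := Presheaf {
  psh_obj :> C -> Type;
  psh_map : forall a b : C, hom a b -> psh_obj b -> psh_obj a;
  psh_id : forall (a : C) (x : psh_obj a), psh_map (idm a) x = x;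
  psh_comp : forall (a b c : C) (g : hom b c) (f : hom a b) (x : psh_obj c),
    psh_map (g ∘ f) x = psh_map f (psh_map g x)
}.

Arguments psh_map {C} p {a b} f x.

Definition natural (C : category) (F G : presheaf C)
    (tau : forall a : C, F a -> G a) : Prop :=
  forall (a b : C) (f : hom a b) (x : F b),
    tau a (psh_map F f x) = psh_map G f (tau b x).

Definition natural_mono (C : category) (F G : presheaf C)
    (tau : forall a : C, F a -> G a) : Prop :=
  natural tau /\ forall a : C, injective (tau a).

Definition Hom_presheaf (C : category) (T : C) : presheaf C :=
  @Presheaf C (fun a => hom a T) (fun a b f x => x ∘ f)
    (fun a x => comp_id_r x) (fun a b c g f x => comp_assoc x g f).

Section SplitExtensions.
Variable C : category.

Record splext (B X : C) := SplExtension {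
  se_obj : C;
  se_ker : hom X se_obj;
  se_proj : hom se_obj B;
  se_sec : hom B se_obj;
  se_split : se_proj ∘ se_sec = idm B;
  se_kernel : is_kernel se_ker se_proj
}.

Definition splext_iso B X (E E' : splext B X) : Prop :=
  exists theta : hom (se_obj E) (se_obj E'),
    [/\ isomorphism theta,
        theta ∘ se_ker E = se_ker E',
        se_proj E' ∘ theta = se_proj E
      & theta ∘ se_sec E = se_sec E'].

Definition iso_class B X (E : splext B X) : splext B X -> Prop :=
  fun E' => splext_iso E E'.

Definition SplExt (B X : C) : Type :=
  {c : splext B X -> Prop | exists E, c = iso_class E}.

(* E' is a pullback of E along f.  The kernel and the section of E' are the
   unique morphisms into the pullback induced by (se_ker E, 0) and by
   (se_sec E ∘ f, id); their second components are the axioms of splext. *)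
Definition splext_pullback B' B X (f : hom B' B)
    (E : splext B X) (E' : splext B' X) : Prop :=
  exists p : hom (se_obj E') (se_obj E),
    [/\ is_pullback p (se_proj E') (se_proj E) f,
        p ∘ se_ker E' = se_ker E
      & p ∘ se_sec E' = se_sec E ∘ f].

Definition pull_class B' B X (f : hom B' B) (c : splext B X -> Prop) :
    splext B' X -> Prop :=
  fun E' => exists2 E, c E & splext_pullback f E E'.

Lemma splext_iso_refl B X (E : splext B X) : splext_iso E E.
Proof.
exists (idm _); split; rewrite ?comp_id_l ?comp_id_r //.
by exists (idm _); rewrite comp_id_l.
Qed.

Lemma splext_iso_sym B X (E E' : splext B X) :
  splext_iso E E' -> splext_iso E' E.
Proof.
move=> [t [[u [ut tu]] tk tp ts]]; exists u; split.
- by exists t.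
- by rewrite -tk comp_assoc ut comp_id_l.
- by rewrite -tp -comp_assoc tu comp_id_r.
- by rewrite -ts comp_assoc ut comp_id_l.
Qed.

Lemma splext_iso_trans B X (E2 E1 E3 : splext B X) :
  splext_iso E1 E2 -> splext_iso E2 E3 -> splext_iso E1 E3.
Proof.
move=> [t [[u [ut tu]] tk tp ts]] [t' [[u' [ut' tu']] tk' tp' ts']].
exists (t' ∘ t); split.
- exists (u ∘ u'); split.
    by rewrite comp_assoc -(comp_assoc u) ut' comp_id_r.
  by rewrite comp_assoc -(comp_assoc t') tu comp_id_r.
- by rewrite -comp_assoc tk.
- by rewrite comp_assoc tp'.
- by rewrite -comp_assoc ts.
Qed.

Lemma zero_comp_r (a b c : C) (f : hom a b) (g : hom b c) :
  zero_morphism f -> zero_morphism (g ∘ f).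
Proof.
by move=> [z [u [v [zz ->]]]]; exists z, (g ∘ u), v; rewrite comp_assoc.
Qed.

Lemma zero_unique (a b : C) (f g : hom a b) :
  zero_morphism f -> zero_morphism g -> f = g.
Proof.
move=> [z [u [v [zz ->]]]] [z' [u' [v' [zz' ->]]]].
have [_ [y [_ yU]]] := zz b; have [[w [_ wU]] _] := zz' a.
have [[m _] _] := zz' z.
by rewrite -(yU u I) (yU (u' ∘ m) I) -comp_assoc -(wU (m ∘ v) I) (wU v' I).
Qed.

Lemma zero_hom_exists (a b z : C) :
  zero_object z -> exists f : hom a b, zero_morphism f.
Proof.
move=> zz; have [[v _] _] := zz a; have [_ [u _]] := zz b.
by exists (u ∘ v), z, u, v.
Qed.

Lemma splext_pullback_exists (hC : has_pullbacks C) B' B X (f : hom B' B)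
    (E : splext B X) : exists E', splext_pullback f E E'.
Proof.
have [P [p [q [sq PU]]]] := hC _ _ _ (se_proj E) f.
have [k0 kU] := se_kernel E.
have [z [_ [_ [zz _]]]] := k0.
have [o o0] := @zero_hom_exists X B' z zz.
have [k [[pk qk] _]] := PU _ (se_ker E) o
  (zero_unique k0 (zero_comp_r f o0)).
have e : se_proj E ∘ (se_sec E ∘ f) = f ∘ idm B'.
  by rewrite comp_assoc se_split comp_id_l comp_id_r.
have [s [[ps qs] _]] := PU _ _ _ e.
have kk : is_kernel k q.
  split; first by rewrite qk.
  move=> c g g0.
  have pg0 : zero_morphism (se_proj E ∘ (p ∘ g)).
    by rewrite comp_assoc sq -comp_assoc; exact: zero_comp_r.
  have [h [kh hU]] := kU _ _ pg0.
  exists h; split; last first.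
    by move=> h' kh'; apply: hU; rewrite -kh' comp_assoc pk.
  have [w [_ wU]] := PU c (p ∘ g) (q ∘ g)
    (zero_unique pg0 (zero_comp_r f g0)).
  rewrite -(wU (k ∘ h)) ?(wU g) //; split.
    by rewrite comp_assoc pk.
  rewrite comp_assoc qk; apply: zero_unique g0.
  have [z' [u [v [zz' ->]]]] := o0.
  by exists z', u, (v ∘ h); rewrite comp_assoc.
by exists (SplExtension qs kk), p; split.
Qed.

Lemma splext_pullback_iso B' B X (f : hom B' B) (E : splext B X)
    (E1 E2 : splext B' X) :
  splext_pullback f E E1 -> splext_pullback f E E2 -> splext_iso E1 E2.
Proof.
move=> [p [[sq PU] pk ps]] [p' [[sq' PU'] pk' ps']].
have [t [[pt qt] _]] := PU' _ _ _ sq.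
have [t' [[pt' qt'] _]] := PU _ _ _ sq'.
have zE F : zero_morphism (se_proj F ∘ @se_ker B' X F).
  by have [] := se_kernel F.
exists t; split => //.
- exists t'; split.
    have [w [_ wU]] := PU _ _ _ sq.
    by rewrite -(wU (t' ∘ t)) ?(wU (idm _)) // ?comp_id_r // !comp_assoc
       pt' qt'.
  have [w [_ wU]] := PU' _ _ _ sq'.
  by rewrite -(wU (t ∘ t')) ?(wU (idm _)) // ?comp_id_r // !comp_assoc pt qt.
- have [|w [_ wU]] := PU' _ (se_ker E) (se_proj E2 ∘ se_ker E2).
    by rewrite -pk' !comp_assoc sq'.
  rewrite -(wU (t ∘ se_ker E1)) ?(wU (se_ker E2)) //.
  rewrite !comp_assoc pt qt; split=> //; exact: zero_unique.
- have [|w [_ wU]] := PU' _ (se_sec E ∘ f) (idm _).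
    by rewrite comp_assoc se_split comp_id_l comp_id_r.
  rewrite -(wU (t ∘ se_sec E1)) ?(wU (se_sec E2)) ?se_split //.
  by rewrite !comp_assoc pt qt se_split.
Qed.

Lemma splext_pullback_isor B' B X (f : hom B' B) (E : splext B X)
    (E1 E2 : splext B' X) :
  splext_pullback f E E1 -> splext_iso E1 E2 -> splext_pullback f E E2.
Proof.
move=> [p [[sq PU] pk ps]] [t [[u [ut tu]] tk tp ts]].
exists (p ∘ u); split; last 2 first.
- by rewrite -tk comp_assoc -(comp_assoc p) ut comp_id_r.
- by rewrite -ts comp_assoc -(comp_assoc p) ut comp_id_r.
have pu : se_proj E1 ∘ u = se_proj E2.
  by rewrite -tp -comp_assoc tu comp_id_r.
split; first by rewrite comp_assoc sq -comp_assoc pu.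
move=> d v w vw; have [h [[ph qh] hU]] := PU _ _ _ vw.
exists (t ∘ h); split.
  split; last by rewrite comp_assoc tp.
  by rewrite comp_assoc -(comp_assoc p) ut comp_id_r.
move=> h' [ph' qh']; rewrite (hU (u ∘ h')).
  by rewrite comp_assoc tu comp_id_l.
by rewrite !comp_assoc pu.
Qed.

Lemma splext_pullback_isol B' B X (f : hom B' B) (E1 E2 : splext B X)
    (E' : splext B' X) :
  splext_iso E1 E2 -> splext_pullback f E1 E' -> splext_pullback f E2 E'.
Proof.
move=> [t [[u [ut tu]] tk tp ts]] [p [[sq PU] pk ps]].
exists (t ∘ p); split; last 2 first.
- by rewrite -comp_assoc pk.
- by rewrite -comp_assoc ps comp_assoc ts.
have pu : se_proj E1 ∘ u = se_proj E2.
  by rewrite -tp -comp_assoc tu comp_id_r.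
split; first by rewrite comp_assoc tp.
move=> d v w vw.
have [|h [[ph qh] hU]] := PU _ (u ∘ v) w; first by rewrite comp_assoc pu.
exists h; split.
  by split=> //; rewrite -comp_assoc ph comp_assoc tu comp_id_l.
move=> h' [ph' qh']; apply: hU; split=> //.
by rewrite -ph' !comp_assoc ut comp_id_l.
Qed.

Lemma splext_pullback_id B X (E : splext B X) : splext_pullback (idm B) E E.
Proof.
exists (idm _); split; last 2 first.
- by rewrite comp_id_l.
- by rewrite comp_id_l comp_id_r.
split; first by rewrite comp_id_l comp_id_r.
move=> d u v; rewrite comp_id_l => e; exists u.
by split; [split; rewrite ?comp_id_l|move=> h [<- _]; rewrite comp_id_l].
Qed.

Lemma splext_pullback_comp B'' B' B X (g : hom B' B) (f : hom B'' B')
    (E : splext B X) (E' : splext B' X) (E'' : splext B'' X) :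
  splext_pullback g E E' -> splext_pullback f E' E'' ->
  splext_pullback (g ∘ f) E E''.
Proof.
move=> [p [[sq PU] pk ps]] [p' [[sq' PU'] pk' ps']].
exists (p ∘ p'); split; last 2 first.
- by rewrite -comp_assoc pk'.
- by rewrite -comp_assoc ps' comp_assoc ps comp_assoc.
split; first by rewrite comp_assoc sq -comp_assoc sq' comp_assoc.
move=> d u v; rewrite -comp_assoc => uv.
have [h [[ph qh] hU]] := PU _ _ _ uv.
have [k [[pk2 qk] kU]] := PU' _ _ _ qh.
exists k; split; first by rewrite -comp_assoc pk2.
move=> k' [e1 e2]; apply: kU; split=> //; apply/esym/hU; split.
  by rewrite comp_assoc.
by rewrite comp_assoc sq' -comp_assoc e2.
Qed.

Lemma pull_class_iso_class B' B X (f : hom B' B) (E : splext B X) E' :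
  splext_pullback f E E' -> pull_class f (iso_class E) = iso_class E'.
Proof.
move=> EE'; apply/predeqP => F; split=> [[E1 EE1 E1F]|E'F].
  apply: splext_pullback_iso EE' _; apply: splext_pullback_isol E1F.
  exact: splext_iso_sym.
exists E; first exact: splext_iso_refl.
exact: splext_pullback_isor E'F.
Qed.

Variable hC : has_pullbacks C.

Lemma pull_class_subproof B' B X (f : hom B' B) (c : SplExt B X) :
  exists E', pull_class f (sval c) = iso_class E'.
Proof.
case: c => c /= [E ->]; have [E' EE'] := splext_pullback_exists hC f E.
by exists E'; apply: pull_class_iso_class.
Qed.

Definition SplExt_map X B' B (f : hom B' B) (c : SplExt B X) : SplExt B' X :=
  exist _ (pull_class f (sval c)) (pull_class_subproof f c).

Lemma SplExt_map_id X B (c : SplExt B X) : SplExt_map (idm B) c = c.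
Proof.
case: c => c cE; apply: eq_exist; case: cE => /= E ->.
exact/pull_class_iso_class/splext_pullback_id.
Qed.

Lemma SplExt_map_comp X B'' B' B (g : hom B' B) (f : hom B'' B')
    (c : SplExt B X) :
  SplExt_map (g ∘ f) c = SplExt_map f (SplExt_map g c).
Proof.
apply: eq_exist; case: c => c /= [E ->].
have [E' EE'] := splext_pullback_exists hC g E.
have [E'' EE''] := splext_pullback_exists hC f E'.
rewrite (pull_class_iso_class EE') (pull_class_iso_class EE'').
exact/pull_class_iso_class/(splext_pullback_comp EE').
Qed.

Definition SplExt_presheaf (X : C) : presheaf C :=
  @Presheaf C (fun B => SplExt B X) (@SplExt_map X)
    (@SplExt_map_id X) (@SplExt_map_comp X).

End SplitExtensions.

(* Pullbacks are the only part of semi-abelianness needed to state this: they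
   make SplExt(-, X) a functor, and kernels are taken with respect to the zero
   morphisms (those factoring through a zero object). *)
Definition weakly_action_representable (C : category) (hC : has_pullbacks C) :
    Prop :=
  forall X : C, exists T : C,
    exists tau : forall B : C, SplExt_presheaf hC X B -> Hom_presheaf T B,
      natural_mono tau.

(* Groups are the possibly infinite groupType; its choice structure is no
   restriction, every type having one classically (gen_choiceMixin), and
   morphisms ignore it. *)
Section TwoSolvable.
Local Open Scope group_scope.

Definition subgroup (G : groupType) (H : set G) : Prop :=
  H 1 /\ forall x y, H x -> H y -> H (x / y).

Definition commutator_subgroup (G : groupType) (H K : set G) : set G :=
  smallest (@subgroup G) [set z | exists x y, [/\ H x, K y & z = [~ x, y]]].

Definition derived_subgroup (G : groupType) (H : set G) : set G :=
  commutator_subgroup H H.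

Definition two_solvable (G : groupType) : Prop :=
  derived_subgroup (derived_subgroup [set: G]) = [set 1].

Record two_solvable_group := TwoSolvableGroup {
  tsg_sort :> groupType;
  tsg_solvable : two_solvable tsg_sort
}.

Definition grp_hom (G H : groupType) : Type := UMagmaMorphism.type G H.

Lemma grp_hom_eq (G H : groupType) (f g : grp_hom G H) : f =1 g -> f = g.
Proof.
case: f g => [f [[f1] [fM]]] [g [[g1] [gM]]] /funext /= fg.
move: f1 fM g1 gM; rewrite fg => f1 fM g1 gM.
by rewrite (Prop_irrelevance f1 g1) (Prop_irrelevance fM gM).
Qed.

Definition grp_id (G : groupType) : grp_hom G G := idfun.

Definition grp_comp (G H K : groupType) (g : grp_hom H K) (f : grp_hom G H) :
  grp_hom G K := g \o f.

Lemma grp_comp_id_l (G H : groupType) (f : grp_hom G H) :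
  grp_comp (grp_id H) f = f.
Proof. exact: grp_hom_eq. Qed.

Lemma grp_comp_id_r (G H : groupType) (f : grp_hom G H) :
  grp_comp f (grp_id G) = f.
Proof. exact: grp_hom_eq. Qed.

Lemma grp_comp_assoc (G H K L : groupType)
    (h : grp_hom K L) (g : grp_hom H K) (f : grp_hom G H) :
  grp_comp h (grp_comp g f) = grp_comp (grp_comp h g) f.
Proof. exact: grp_hom_eq. Qed.

Definition two_solvable_groups : category :=
  @Category two_solvable_group (fun G H => grp_hom G H) (fun G => grp_id G)
    (fun G H K g f => grp_comp g f) (fun G H f => grp_comp_id_l f)
    (fun G H f => grp_comp_id_r f) (fun G H K L h g f => grp_comp_assoc h g f).

Lemma commutator_subgroup1 (G : groupType) (H K : set G) :
  commutator_subgroup H K 1.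
Proof. by move=> A [[]]. Qed.

Lemma commutator_subgroup_hom (G H : groupType) (f : grp_hom G H)
    (A B : set G) (A' B' : set H) :
  (forall x, A x -> A' (f x)) -> (forall x, B x -> B' (f x)) ->
  forall x, commutator_subgroup A B x -> commutator_subgroup A' B' (f x).
Proof.
move=> fA fB x ABx M [[M1 MF] sM]; have := ABx (f @^-1` M); apply; split.
  by split=> [|y z My Mz]; rewrite /= ?gmulf1 // gmulfF; apply: MF.
move=> _ [y [z [Ay Bz ->]]]; rewrite /= gmulfR; apply: sM.
by exists (f y), (f z); split; [exact: fA|exact: fB|].
Qed.

Lemma two_solvable_jointly_injective (P A B : groupType)
    (f : grp_hom P A) (g : grp_hom P B) :
  two_solvable A -> two_solvable B ->
  (forall x, f x = 1 -> g x = 1 -> x = 1) -> two_solvable P.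
Proof.
move=> sA sB inj; apply/seteqP; split=> [x Px|_ ->]; last first.
  exact: commutator_subgroup1.
have dP Q (h : grp_hom P Q) : two_solvable Q -> h x = 1.
  move=> sQ; suff : [set 1] (h x) by [].
  have d1 y : derived_subgroup [set: P] y -> derived_subgroup [set: Q] (h y).
    exact: commutator_subgroup_hom.
  by rewrite -sQ; exact: (commutator_subgroup_hom d1 d1 Px).
by apply: inj; apply: dP.
Qed.

Section Pullback.
Variables (A B D : groupType) (f : grp_hom A D) (g : grp_hom B D).

Definition fiber_pred : {pred A * B} := fun x => f x.1 == g x.2.

Lemma fiber_group_closed : group_closed fiber_pred.
Proof.
split=> [|x y]; first by rewrite unfold_in /= !gmulf1.
rewrite !unfold_in => /eqP fx /eqP fy; apply/eqP.
by rewrite /= !gmulfF fx fy.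
Qed.

Record fiber := Fiber { fiber_val :> A * B; _ : fiber_val \in fiber_pred }.
HB.instance Definition _ := [isSub for fiber_val].
HB.instance Definition _ := [Choice of fiber by <:].
HB.instance Definition _ :=
  SubChoice_isSubGroup.Build (A * B)%type fiber_pred fiber fiber_group_closed.

Definition fiber_fst (x : fiber) : A := (val x).1.
Definition fiber_snd (x : fiber) : B := (val x).2.

Lemma fiber_fst_morphism : monoid_morphism fiber_fst.
Proof. by split=> [|x y]; rewrite /fiber_fst ?val1 ?valM. Qed.

Lemma fiber_snd_morphism : monoid_morphism fiber_snd.
Proof. by split=> [|x y]; rewrite /fiber_snd ?val1 ?valM. Qed.

HB.instance Definition _ :=
  isUMagmaMorphism.Build fiber A fiber_fst fiber_fst_morphism.
HB.instance Definition _ :=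
  isUMagmaMorphism.Build fiber B fiber_snd fiber_snd_morphism.

Lemma fiberP (x : fiber) : f (fiber_fst x) = g (fiber_snd x).
Proof. exact/eqP/(valP x). Qed.

Section Pairing.
Variables (K : groupType) (u : grp_hom K A) (v : grp_hom K B).
Hypothesis uv : forall x, f (u x) = g (v x).

Lemma fiber_pair_subproof x : (u x, v x) \in fiber_pred.
Proof. exact/eqP/uv. Qed.

Definition fiber_pair x : fiber := Fiber (fiber_pair_subproof x).

Lemma fiber_pair_morphism : monoid_morphism fiber_pair.
Proof.
split=> [|x y]; apply: val_inj; rewrite ?val1 ?valM /=.
  by rewrite !gmulf1.
by rewrite !gmulfM.
Qed.

HB.instance Definition _ :=
  isUMagmaMorphism.Build K fiber fiber_pair fiber_pair_morphism.

Definition fiber_pair_hom : grp_hom K fiber := fiber_pair.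
End Pairing.

End Pullback.

Lemma two_solvable_groups_has_pullbacks : has_pullbacks two_solvable_groups.
Proof.
move=> A B D f g.
pose p1 : grp_hom (fiber f g) A := @fiber_fst _ _ _ f g.
pose p2 : grp_hom (fiber f g) B := @fiber_snd _ _ _ f g.
have sP : two_solvable (fiber f g).
  apply: (two_solvable_jointly_injective (f := p1) (g := p2));
    [exact: tsg_solvable|exact: tsg_solvable|].
  move=> x x1 x2; apply: val_inj; rewrite val1.
  by rewrite [val x]surjective_pairing; congr pair.
exists (TwoSolvableGroup sP), p1, p2; split.
  by apply: grp_hom_eq => x; apply: fiberP.
move=> K u v uv.
have uvE x : f (u x) = g (v x).
  by have /(congr1 (fun h : grp_hom K D => h x)) := uv.
exists (fiber_pair_hom uvE); split; first by split; apply: grp_hom_eq.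
move=> h [hu hv]; apply: grp_hom_eq => x; apply: val_inj.
by rewrite /= -hu -hv [RHS]surjective_pairing.
Qed.

End TwoSolvable.

(* Main.v *)
(* If [tau] embeds SplExt(-, X) into Hom(-, T), then the element of T assigned
   to an automorphism of X by restricting an action to a copy of Z depends on
   that automorphism only, and distinct automorphisms get distinct elements.
   Take X = Z^3 and let t_ij(n) in T be assigned to the transvection I + n e_ij.
   The Heisenberg group generated by e_ij and e_jk acts on X with a semidirect
   product isomorphic to the unitriangular 4x4 matrices, which is metabelian;
   so t_ik(n) = [t_ij(n), t_jk(1)] in T for all distinct i, j, k. Hence
   t_12(n) = [t_13(n), t_32(1)] and t_23(1) = [t_21(1), t_13(1)] lie in T', and
   t_13(n) = [t_12(n), t_23(1)] lies in T'' = 1, although I + e_13 is not the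
   identity. *)
From HB Require Import structures.
From mathcomp Require Import all_boot ssralg zmodp ssrint ring.
From mathcomp Require Import boolp classical_sets.
Require Import Defs.

Set Implicit Arguments.
Unset Strict Implicit.
Unset Printing Implicit Defensive.

Local Open Scope classical_set_scope.
Local Open Scope group_scope.

(** * Homomorphisms from multiplicative maps *)

Section MorphicFunctions.
Variables (G H : groupType) (f : G -> H).

(** The proof is an argument so that a homomorphism structure depending on it can be attached to the
    term. *)
Definition morphic_fun of {morph f : x y / x * y} : G -> H := f.

Hypothesis fM : {morph f : x y / x * y}.

Lemma morphic_fun_morphism : monoid_morphism (morphic_fun fM).
Proof.
by split=> //; apply: (mulgI (f 1)); rewrite mulg1 -[in RHS](mulg1 1) fM.
Qed.

HB.instance Definition _ :=
  isUMagmaMorphism.Build G H (morphic_fun fM) morphic_fun_morphism.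

Definition hom_of_morphic : grp_hom G H := morphic_fun fM.

End MorphicFunctions.

(** * Criteria for derived length at most two *)

Lemma derived_subgroup_ind (G : groupType) (A H : set G) :
  subgroup H -> (forall x y, A x -> A y -> H [~ x, y]) ->
  derived_subgroup A `<=` H.
Proof.
move=> sH cH x; apply; split=> // _ [y [z [Ay Az ->]]]; exact: cH.
Qed.

Lemma mem_derived_commutator (G : groupType) (A : set G) (x y : G) :
  A x -> A y -> derived_subgroup A [~ x, y].
Proof. by move=> Ax Ay M [_]; apply; exists x, y. Qed.

(** Commutators die in the abelian group [Q], so G' lies in the kernel of [p]; elements of that
    kernel commute, whence G'' = 1. *)
Lemma two_solvable_abelian_extension (G Q : groupType) (p : grp_hom G Q) :
  commutative (@mul Q) ->
  (forall x y, p x = 1 -> p y = 1 -> commute x y) -> two_solvable G.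
Proof.
move=> Qab kab.
have dp : derived_subgroup [set: G] `<=` [set x | p x = 1].
  apply: derived_subgroup_ind => [|x y _ _] /=.
    by split=> [|x y /= x1 y1]; rewrite /= ?gmulf1 // gmulfF x1 y1 divg1.
  by rewrite gmulfR; apply/eqP/commgP/Qab.
apply/seteqP; split=> [|_ ->]; last exact: commutator_subgroup1.
apply: derived_subgroup_ind => [|x y /dp x1 /dp y1].
  by split=> //= x y -> ->; rewrite divg1.
exact/eqP/commgP/kab.
Qed.

Lemma two_solvable_abelian (G : groupType) :
  commutative (@mul G) -> two_solvable G.
Proof.
by move=> Gab; apply: (two_solvable_abelian_extension (p := grp_id G)).
Qed.

(** * Zero morphisms are the trivial homomorphisms *)

Lemma zero_morphism1 (G H : two_solvable_groups) (f : hom G H) :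
  zero_morphism f -> forall x, f x = 1.
Proof.
move=> [z [g [h [zz ->]]]] x; have [[i [_ iU]] _] := zz z.
have oM : {morph (fun _ : z => 1 : z) : u v / u * v} by move=> *; rewrite mulg1.
(* Endomorphisms of a zero object are unique, so its identity is constant. *)
have e : idm z = hom_of_morphic oM.
  by rewrite -(iU (idm z)) // -(iU (hom_of_morphic oM)).
have /= hx := congr1 (fun k : hom z z => k (h x)) e.
by rewrite /= hx gmulf1.
Qed.

Lemma zero_morphismP (G H : two_solvable_groups) (f : hom G H) :
  zero_morphism f <-> forall x, f x = 1.
Proof.
split=> [|f1]; first exact: zero_morphism1.
have iM (A B : groupType) : {morph (fun _ : A => 1 : B) : u v / u * v}.
  by move=> *; rewrite mulg1.
(* The trivial group ['I_1] serves as zero object. *)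
pose z : two_solvable_groups := TwoSolvableGroup
  (two_solvable_abelian (fun x y : 'I_1 => etrans (ord1 _) (esym (ord1 _)))).
exists z, (hom_of_morphic (iM z H)), (hom_of_morphic (iM G z)); split.
  move=> A; split.
    exists (hom_of_morphic (iM A z)); split=> // g _; apply: grp_hom_eq => x.
    by rewrite (ord1 (g x)) (ord1 (_ x)).
  exists (hom_of_morphic (iM z A)); split=> // g _; apply: grp_hom_eq => x.
  by rewrite (ord1 x) !gmulf1.
by apply: grp_hom_eq => x; rewrite f1.
Qed.

(** * Group actions and semidirect products *)

Record grp_action (B X : groupType) := GrpAction {
  act :> B -> X -> X;
  act1 : forall x, act 1 x = x;
  actM : forall b c x, act (b * c) x = act b (act c x);
  act_morph : forall b, {morph act b : x y / x * y}
}.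

Lemma grp_action_eq (B X : groupType) (a a' : grp_action B X) :
  (forall b x, a b x = a' b x) -> a = a'.
Proof.
case: a a' => [a a1 aM am] [a' a1' aM' am'] /= aa'.
have e : a = a' by apply/funext => b; apply/funext => x.
by subst a'; congr GrpAction; apply: Prop_irrelevance.
Qed.

Section RestrictAction.
Variables (B C X : groupType) (f : grp_hom C B) (a : grp_action B X).

Definition restrict_action : grp_action C X.
Proof.
apply: (@GrpAction _ _ (fun c x => a (f c) x)) => [x|b c x|b x y].
- by rewrite gmulf1 act1.
- by rewrite gmulfM actM.
- by rewrite act_morph.
Defined.

End RestrictAction.

Section ConjugateAction.
Variables (B X : groupType) (s : grp_hom X X) (sK : involutive s).
Variable a : grp_action B X.

Definition conjugate_action : grp_action B X.
Proof.
apply: (@GrpAction _ _ (fun c x => s (a c (s x)))) => [x|b c x|b x y].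
- by rewrite act1 sK.
- by rewrite actM sK.
- by rewrite -gmulfM -act_morph -gmulfM.
Defined.

End ConjugateAction.

Section SemidirectProduct.
Variables (B X : groupType) (a : grp_action B X).

Lemma act_1r b : a b 1 = 1.
Proof. by apply: (mulgI (a b 1)); rewrite -act_morph !mulg1. Qed.

Definition semidirect of grp_action B X : Type := (X * B)%type.
Local Notation A := (semidirect a).

HB.instance Definition _ := Choice.copy A (X * B)%type.

Definition semidirect_mul (u v : A) : A := (u.1 * a u.2 v.1, u.2 * v.2).
Definition semidirect_inv (u : A) : A := (a u.2^-1 u.1^-1, u.2^-1).
Definition semidirect_one : A := (1, 1).

Lemma semidirect_mulA : associative semidirect_mul.
Proof.
by move=> u v w; rewrite /semidirect_mul /= act_morph actM !mulgA.
Qed.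

Lemma semidirect_mul1 : left_id semidirect_one semidirect_mul.
Proof. by move=> [x b]; rewrite /semidirect_mul /= act1 !mul1g. Qed.

Lemma semidirect_1mul : right_id semidirect_one semidirect_mul.
Proof. by move=> [x b]; rewrite /semidirect_mul /= act_1r !mulg1. Qed.

Lemma semidirect_mulV :
  left_inverse semidirect_one semidirect_inv semidirect_mul.
Proof.
move=> [x b]; rewrite /semidirect_mul /= -act_morph !mulVg.
by rewrite act_1r.
Qed.

Lemma semidirect_Vmul :
  right_inverse semidirect_one semidirect_inv semidirect_mul.
Proof.
by move=> [x b]; rewrite /semidirect_mul /= -actM !mulgV act1 mulgV.
Qed.

HB.instance Definition _ := isGroup.Build A
  semidirect_mulA semidirect_mul1 semidirect_1mul
  semidirect_mulV semidirect_Vmul.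

Definition semidirect_inl (x : X) : A := (x, 1).
Definition semidirect_inr (b : B) : A := (1, b).
Definition semidirect_pr (u : A) : B := u.2.

Lemma semidirect_inl_morph : {morph semidirect_inl : x y / x * y}.
Proof. by move=> x y; congr pair; rewrite /= ?act1 ?mulg1. Qed.

Lemma semidirect_inr_morph : {morph semidirect_inr : x y / x * y}.
Proof. by move=> x y; congr pair; rewrite /= act_1r mulg1. Qed.

Lemma semidirect_pr_morph : {morph semidirect_pr : x y / x * y}.
Proof. by []. Qed.

End SemidirectProduct.

Arguments semidirect {B X} a.

(** * Split extensions given by semidirect products, and their pullbacks *)

Section SemidirectExtension.
Variables (B X : two_solvable_groups) (a : grp_action B X).
Hypothesis solA : two_solvable (semidirect a).

Let A : two_solvable_groups := TwoSolvableGroup solA.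
Let inl : hom X A := hom_of_morphic (@semidirect_inl_morph B X a).
Let inr : hom B A := hom_of_morphic (@semidirect_inr_morph B X a).
Let pr : hom A B := hom_of_morphic (@semidirect_pr_morph B X a).

Lemma semidirect_split : comp pr inr = idm B.
Proof. exact: grp_hom_eq. Qed.

Lemma semidirect_kernel : is_kernel inl pr.
Proof.
split; first by apply/zero_morphismP.
move=> G g /zero_morphismP g1.
(* On elements with trivial [B]-component the twist by the action disappears, so the first
   projection is multiplicative. *)
have gM : {morph (fun y => (g y).1) : y z / y * z}.
  move=> y z; rewrite gmulfM /=.
  have -> : (g y).2 = 1 := g1 y.
  by rewrite act1.
exists (hom_of_morphic gM : hom G X); split.
  apply: grp_hom_eq => y; rewrite [RHS]surjective_pairing; congr pair.
  exact/esym/g1.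
by move=> h hg; apply: grp_hom_eq => y; rewrite /= /morphic_fun -hg.
Qed.

Definition semidirect_ext : splext B X :=
  SplExtension semidirect_split semidirect_kernel.

Definition semidirect_class : SplExt B X :=
  exist _ (iso_class semidirect_ext) (ex_intro _ semidirect_ext erefl).

End SemidirectExtension.

Lemma semidirect_class_eq (B X : two_solvable_groups) (a a' : grp_action B X)
    (sa : two_solvable (semidirect a)) (sa' : two_solvable (semidirect a')) :
  (forall b x, a b x = a' b x) -> semidirect_class sa = semidirect_class sa'.
Proof.
by move=> /grp_action_eq aa'; subst a'; rewrite (Prop_irrelevance sa sa').
Qed.

(** The action can be read off from the relation inr b * inl x = inl (a b x) * inr b, and an
    isomorphism of split extensions preserves [inl] and [inr]. *)
Lemma semidirect_class_inj (B X : two_solvable_groups) (a a' : grp_action B X)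
    (sa : two_solvable (semidirect a)) (sa' : two_solvable (semidirect a')) :
  semidirect_class sa = semidirect_class sa' -> forall b x, a b x = a' b x.
Proof.
move=> /(congr1 sval) /= e b x.
have : iso_class (semidirect_ext sa) (semidirect_ext sa').
  by rewrite e; apply: splext_iso_refl.
move=> [t [_ tk _ ts]].
have tl y : t (semidirect_inl a y) = semidirect_inl a' y.
  exact: (congr1 (fun h : hom X (TwoSolvableGroup sa') => h y) tk).
have tr c : t (semidirect_inr a c) = semidirect_inr a' c.
  exact: (congr1 (fun h : hom B (TwoSolvableGroup sa') => h c) ts).
have eA (c : grp_action B X) :
    semidirect_inr c b * semidirect_inl c x =
    semidirect_inl c (c b x) * semidirect_inr c b.
  by congr pair; rewrite /= ?mul1g ?act_1r ?mulg1.
have := congr1 t (eA a); rewrite !gmulfM !tl !tr eA => /mulIg.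
by move=> /(congr1 fst).
Qed.

(** The maps (x, c) -> (x, f c) and (x, c) -> c are jointly injective homomorphisms into 2-solvable
    groups. *)
Lemma restrict_action_two_solvable (B C X : groupType) (f : grp_hom C B)
    (a : grp_action B X) :
  two_solvable C -> two_solvable (semidirect a) ->
  two_solvable (semidirect (restrict_action f a)).
Proof.
move=> sC sa; pose g (u : semidirect (restrict_action f a)) : semidirect a :=
  (u.1, f u.2).
have gM : {morph g : u v / u * v} by move=> u v; congr pair; rewrite gmulfM.
apply: (two_solvable_jointly_injective (f := hom_of_morphic gM)
  (g := hom_of_morphic (@semidirect_pr_morph _ _ (restrict_action f a)))) => //.
by move=> [x c] /(congr1 fst) x1 c1; congr pair.
Qed.

(** The map (x, b) -> (s x, b) embeds the new semidirect product into the old one. *)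
Lemma conjugate_action_two_solvable (B X : groupType) (s : grp_hom X X)
    (sK : involutive s) (a : grp_action B X) :
  two_solvable (semidirect a) ->
  two_solvable (semidirect (conjugate_action sK a)).
Proof.
move=> sa; pose g (u : semidirect (conjugate_action sK a)) : semidirect a :=
  (s u.1, u.2).
have gM : {morph g : u v / u * v}.
  by move=> u v; congr pair; rewrite /= gmulfM sK.
apply: (two_solvable_jointly_injective (f := hom_of_morphic gM)
  (g := hom_of_morphic gM)) => //.
move=> [x c] e _; congr pair; last exact: (congr1 snd e).
have sx : s x = 1 := congr1 fst e.
by rewrite -[LHS]sK sx gmulf1.
Qed.

(** A pair of [u] in the semidirect product and [c] in [C] with u.2 = f c amounts to the pair (u.1,
    c). *)
Lemma semidirect_pullback (B C X : two_solvable_groups) (f : hom C B)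
    (a : grp_action B X) (sa : two_solvable (semidirect a))
    (sf : two_solvable (semidirect (restrict_action f a))) :
  splext_pullback f (semidirect_ext sa) (semidirect_ext sf).
Proof.
pose g (u : semidirect (restrict_action f a)) : semidirect a := (u.1, f u.2).
have gM : {morph g : u v / u * v} by move=> u v; congr pair; rewrite gmulfM.
pose Af : two_solvable_groups := TwoSolvableGroup sf.
pose p : hom Af (TwoSolvableGroup sa) := hom_of_morphic gM.
exists p; split; last 2 first.
- by apply: grp_hom_eq => x; congr pair; rewrite gmulf1.
- exact: grp_hom_eq.
split; first exact: grp_hom_eq.
move=> D u v uv.
have uvE y : (u y).2 = f (v y).
  exact: (congr1 (fun h : hom D B => h y) uv).
pose h0 y : semidirect (restrict_action f a) := ((u y).1, v y).
have hM : {morph h0 : y z / y * z}.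
  by move=> y z; congr pair; rewrite !gmulfM //= -uvE.
exists (hom_of_morphic hM : hom D Af); split.
  split; apply: grp_hom_eq => y //.
  by rewrite [RHS]surjective_pairing uvE.
move=> k [ku kv]; apply: grp_hom_eq => y.
by rewrite [RHS]surjective_pairing /= /morphic_fun /h0 -ku -kv.
Qed.

Lemma SplExt_map_semidirect (B C X : two_solvable_groups) (f : hom C B)
    (a : grp_action B X) (sa : two_solvable (semidirect a))
    (sf : two_solvable (semidirect (restrict_action f a))) :
  SplExt_map two_solvable_groups_has_pullbacks f (semidirect_class sa) =
  semidirect_class sf.
Proof.
by apply: eq_exist; apply/pull_class_iso_class/semidirect_pullback.
Qed.

(** * Additive groups, and the Heisenberg group acting on R^3 *)

Section AdditiveGroup.
Variable V : zmodType.

Definition additive_group : Type := V.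

HB.instance Definition _ := Choice.copy additive_group V.
HB.instance Definition _ := isGroup.Build additive_group
  (@GRing.addrA V) (@GRing.add0r V) (@GRing.addr0 V)
  (@GRing.addNr V) (@GRing.subrr V).

Lemma additive_group_mulE (x y : additive_group) : x * y = (x + y)%R :> V.
Proof. by []. Qed.

Lemma additive_group_mulC : commutative (@mul additive_group).
Proof. exact: GRing.addrC. Qed.

End AdditiveGroup.

Section Heisenberg.
Local Open Scope ring_scope.
Variable R : comNzRingType.

Lemma triple_eq (T : Type) (x y : T * T * T) :
  x.1.1 = y.1.1 -> x.1.2 = y.1.2 -> x.2 = y.2 -> x = y.
Proof. by case: x y => [[? ?] ?] [[? ?] ?] /= -> -> ->. Qed.

(* [(a, b, c)] stands for the matrix [[1, a, c], [0, 1, b], [0, 0, 1]]. *)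
Definition heis : Type := (R * R * R)%type.

HB.instance Definition _ := Choice.copy heis (R * R * R)%type.

Definition heis_mul (h k : heis) : heis :=
  (h.1.1 + k.1.1, h.1.2 + k.1.2, h.2 + k.2 + h.1.1 * k.1.2).
Definition heis_inv (h : heis) : heis :=
  (- h.1.1, - h.1.2, - h.2 + h.1.1 * h.1.2).
Definition heis_one : heis := (0, 0, 0).

Lemma heis_mulA : associative heis_mul.
Proof. by move=> h k l; apply: triple_eq => /=; ring. Qed.

Lemma heis_mul1 : left_id heis_one heis_mul.
Proof. by move=> h; apply: triple_eq => /=; ring. Qed.

Lemma heis_1mul : right_id heis_one heis_mul.
Proof. by move=> h; apply: triple_eq => /=; ring. Qed.

Lemma heis_mulV : left_inverse heis_one heis_inv heis_mul.
Proof. by move=> h; apply: triple_eq => /=; ring. Qed.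

Lemma heis_Vmul : right_inverse heis_one heis_inv heis_mul.
Proof. by move=> h; apply: triple_eq => /=; ring. Qed.

HB.instance Definition _ := isGroup.Build heis
  heis_mulA heis_mul1 heis_1mul heis_mulV heis_Vmul.

Local Notation vec := (additive_group (R * R * R)%type).

(** The matrix of [h] applied to the column vector [x]. *)
Definition heis_act_fun (h : heis) (x : vec) : vec :=
  (x.1.1 + h.1.1 * x.1.2 + h.2 * x.2, x.1.2 + h.1.2 * x.2, x.2).

Definition heis_act : grp_action heis vec.
Proof.
apply: (@GrpAction _ _ heis_act_fun) => [x|h k x|h x y];
  apply: triple_eq => /=; ring.
Defined.

Lemma heis_act_two_solvable : two_solvable (semidirect heis_act).
Proof.
(* View (x, h) as the 4x4 unitriangular matrix with upper left block [h] and last column [x]; [p]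
   reads its superdiagonal, and matrices with zero superdiagonal commute. *)
pose p (u : semidirect heis_act) : vec := (u.2.1.1, u.2.1.2, u.1.2).
have pM : {morph p : u v / (u * v)%g}.
  by move=> u v; apply: triple_eq => /=; ring.
apply: (two_solvable_abelian_extension (p := hom_of_morphic pM)).
  exact: additive_group_mulC.
move=> [[[x1 x2] x3] [[a b] c]] [[[y1 y2] y3] [[a' b'] c']].
move=> [-> -> ->] [-> -> ->].
by congr pair; apply: triple_eq => /=; ring.
Qed.

Lemma heis_two_solvable : two_solvable heis.
Proof.
pose i := hom_of_morphic (@semidirect_inr_morph _ _ heis_act).
apply: (two_solvable_jointly_injective (f := i) (g := i));
  try exact: heis_act_two_solvable.
by move=> h /(congr1 snd).
Qed.

Definition heis12_fun (n : additive_group R) : heis := (n, 0, 0).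
Definition heis23_fun (n : additive_group R) : heis := (0, n, 0).
Definition heis13_fun (n : additive_group R) : heis := (0, 0, n).

Lemma heis12_morph : {morph heis12_fun : m n / (m * n)%g}.
Proof.
by move=> m n; apply: triple_eq; rewrite /= ?additive_group_mulE; ring.
Qed.

Lemma heis23_morph : {morph heis23_fun : m n / (m * n)%g}.
Proof.
by move=> m n; apply: triple_eq; rewrite /= ?additive_group_mulE; ring.
Qed.

Lemma heis13_morph : {morph heis13_fun : m n / (m * n)%g}.
Proof.
by move=> m n; apply: triple_eq; rewrite /= ?additive_group_mulE; ring.
Qed.


Definition heis12 := hom_of_morphic heis12_morph.
Definition heis23 := hom_of_morphic heis23_morph.
Definition heis13 := hom_of_morphic heis13_morph.

Lemma heis_commutator (n : R) : [~ heis12 n, heis23 1%R]%g = heis13 n.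
Proof. by apply: triple_eq => /=; ring. Qed.

(* Conjugating [heis_act] by these swaps makes [heis12], [heis23], [heis13] act
   by the transvections e_21, e_13, e_23 and e_13, e_32, e_12 respectively. *)
Definition swap12_fun (x : vec) : vec := (x.1.2, x.1.1, x.2).
Definition swap23_fun (x : vec) : vec := (x.1.1, x.2, x.1.2).

Lemma swap12_morph : {morph swap12_fun : x y / (x * y)%g}.
Proof. by []. Qed.
Lemma swap23_morph : {morph swap23_fun : x y / (x * y)%g}.
Proof. by []. Qed.

Definition swap12 := hom_of_morphic swap12_morph.
Definition swap23 := hom_of_morphic swap23_morph.

Lemma swap12K : involutive swap12.
Proof. by move=> [[]]. Qed.
Lemma swap23K : involutive swap23.
Proof. by move=> [[]]. Qed.

End Heisenberg.

(** * Weak representations and the contradiction *)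

(** By naturality, composing with [f] is applying [tau] to the restricted action. Equal restrictions
    thus give equal maps; conversely, [tau] is injective and a class determines its action. *)
Lemma weak_representation_eq (X T : two_solvable_groups)
    (tau : forall B, SplExt_presheaf two_solvable_groups_has_pullbacks X B ->
      Hom_presheaf T B) :
  natural_mono tau ->
  forall (B B' C : two_solvable_groups)
    (a : grp_action B X) (a' : grp_action B' X)
    (sa : two_solvable (semidirect a)) (sa' : two_solvable (semidirect a'))
    (f : hom C B) (f' : hom C B'),
  (forall c x, a (f c) x = a' (f' c) x) <->
  (forall c, (tau B (semidirect_class sa) : hom B T) (f c) =
             (tau B' (semidirect_class sa') : hom B' T) (f' c)).
Proof.
move=> [tauN tauI] B B' C a a' sa sa' f f'.
have sf := restrict_action_two_solvable f (tsg_solvable C) sa.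
have sf' := restrict_action_two_solvable f' (tsg_solvable C) sa'.
have e : tau C (semidirect_class sf) =
    comp (tau B (semidirect_class sa) : hom B T) f.
  by rewrite -(SplExt_map_semidirect sa sf); exact: tauN.
have e' : tau C (semidirect_class sf') =
    comp (tau B' (semidirect_class sa') : hom B' T) f'.
  by rewrite -(SplExt_map_semidirect sa' sf'); exact: tauN.
split=> [aa' c|tt' c x].
  have ee : tau C (semidirect_class sf) = tau C (semidirect_class sf').
    by congr (tau C); apply: semidirect_class_eq.
  exact: (congr1 (fun h : hom C T => h c) (etrans (esym e) (etrans ee e'))).
apply: (semidirect_class_inj (sa := sf) (sa' := sf')); apply: tauI.
by rewrite e e'; apply: grp_hom_eq.
Qed.

Theorem corollary2p2 :
  ~ weakly_action_representable two_solvable_groups_has_pullbacks.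
Proof.
pose H : two_solvable_groups := TwoSolvableGroup (heis_two_solvable int).
pose Z : two_solvable_groups :=
  TwoSolvableGroup (two_solvable_abelian (@additive_group_mulC int)).
pose X : two_solvable_groups := TwoSolvableGroup
  (two_solvable_abelian (@additive_group_mulC (int * int * int)%type)).
move=> /(_ X) [T [tau tauP]].
have tau_eq := weak_representation_eq tauP.
pose s := heis_act_two_solvable int.
pose s12 := conjugate_action_two_solvable (@swap12K int) s.
pose s23 := conjugate_action_two_solvable (@swap23K int) s.
pose e12 : hom Z H := heis12 int.
pose e23 : hom Z H := heis23 int.
pose e13 : hom Z H := heis13 int.
pose t : hom H T := tau H (@semidirect_class H X _ s).
pose t12 : hom H T := tau H (@semidirect_class H X _ s12).
pose t23 : hom H T := tau H (@semidirect_class H X _ s23).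
(* Any homomorphism carries the Heisenberg commutator relation into [T]. *)
have tR (u : hom H T) (n : Z) : [~ u (e12 n), u (e23 (1%R : int))] = u (e13 n).
  by rewrite -gmulfR (heis_commutator n).
(* In this and the next three identities both sides come from the same transvection, seen through
   the swapped and the original action. *)
have t23_12 n : t23 (e12 n) = t (e13 n).
  move: n; apply/(tau_eq H H Z _ _ s23 s) => n x.
  by apply: triple_eq; rewrite /= /morphic_fun /=; ring.
have t23_13 n : t23 (e13 n) = t (e12 n).
  move: n; apply/(tau_eq H H Z _ _ s23 s) => n x.
  by apply: triple_eq; rewrite /= /morphic_fun /=; ring.
have t12_13 n : t12 (e13 n) = t (e23 n).
  move: n; apply/(tau_eq H H Z _ _ s12 s) => n x.
  by apply: triple_eq; rewrite /= /morphic_fun /=; ring.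
have t12_23 n : t12 (e23 n) = t (e13 n).
  move: n; apply/(tau_eq H H Z _ _ s12 s) => n x.
  by apply: triple_eq; rewrite /= /morphic_fun /=; ring.
have t13_1 n : t (e13 n) = 1.
  suff : derived_subgroup (derived_subgroup [set: T]) (t (e13 n)).
    by rewrite (tsg_solvable T).
  (* Each entry of this commutator is itself a commutator, found through a swapped action: [t23] for
     [e12], [t12] for [e23]. *)
  rewrite -tR; apply: mem_derived_commutator.
    by rewrite -t23_13 -tR; apply: mem_derived_commutator.
  by rewrite -t12_13 -tR; apply: mem_derived_commutator.
have iM : {morph (fun _ : Z => 1 : H) : u v / u * v}.
  by move=> *; rewrite mulg1.
(* Since [t] cannot tell [e13] from the trivial homomorphism, both must act alike on [X]. *)
have : forall n, t (e13 n) = t ((hom_of_morphic iM : hom Z H) n).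
  by move=> n; rewrite t13_1 gmulf1.
move/(tau_eq H H Z _ _ s s e13 (hom_of_morphic iM)).
(* The matrix I + e_13 sends (0, 0, 1) to (1, 0, 1), while the identity fixes it. *)
by move=> /(_ (1%R : int) (0, 0, 1)%R).
Qed.
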